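(* Let $w\in S_n$ be $1432$-avoiding. Then $\Theta_w:\mathrm{SVRT}(w)\to\mathsf{KKoh}(w)$ is a weight-preserving bijection (i.e. $\mathrm{wt}(\Theta_w(T))=\mathrm{wt}(T)$ for all $T$) with inverse $\Xi_w$.
   Context: Cells of $[n]\times[n]$ are indexed in matrix notation: $(i,j)$ is row $i$ (from the top), column $j$ (from the left). A permutation $w$ is $1432$-avoiding if there are no indices $j_1<j_2<j_3<j_4$ with $w(j_1)<w(j_4)<w(j_3)<w(j_2)$. The Rothe diagram of $w\in S_n$ is $D(w)=\{(i,j)\in[n]^2: i<w^{-1}(j),\ j<w(i)\}$. A grave diagram is a pair $E=(B,G)$ of disjoint subsets of $[n]\times[n]$; cells of $B$ are boxes, cells of $G$ are ghosts, cells of $B\cup G$ are occupied; $\mathrm{wt}(E)_i=\#\{j:(i,j)\in B\cup G\}$. Suppose $(i,j)\in B$ is rightmost among all occupied cells in row $i$; let $i'=\max\{r: 1\leq r<i,\ (r,j)\notin B\cup G\}$; assume $i'$ exists and every occupied cell $(r,j)$ with $i'<r\leq i$ is a box. The ordinary Kohnert move at row $i$ is $(B,G)\mapsto((B\setminus\{(i,j)\})\cup\{(i',j)\},G)$; the $K$-Kohnert move at row $i$ is $(B,G)\mapsto((B\setminus\{(i,j)\})\cup\{(i',j)\},G\cup\{(i,j)\})$. $\mathsf{KKoh}(w)$ is the closure of $(D(w),\varnothing)$ under ordinary and $K$-Kohnert moves. A flagged set-valued Rothe tableau of shape $D(w)$ is a map $T:D(w)\to 2^{[n]}\setminus\{\varnothing\}$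 such that, whenever the relevant cells lie in $D(w)$: (row) $\min T(r,c)\geq\max T(r,c')$ if $c<c'$; (column) $\max T(r,c)<\min T(r',c)$ if $r<r'$; (flag) $\max T(r,c)\leq r$. $\mathrm{SVRT}(w)$ is the set of these; $\mathrm{wt}(T)_i=\#\{(r,c)\in D(w): i\in T(r,c)\}$. For $T\in\mathrm{SVRT}(w)$, $\Theta_w(T)=(B_T,G_T)$ where $B_T=\{(\min T(r,c),c):(r,c)\in D(w)\}$ and $G_T=\{(a,c): \exists (r,c)\in D(w),\ a\in T(r,c),\ a>\min T(r,c)\}$. A column of a grave diagram $E$ is threaded if it is empty or its topmost occupied cell is a box; then its occupied cells, read from north to south, split uniquely into threads, each thread consisting of a box together with all ghosts below it and above the next box of that column (if any). $E$ is thread-compatible with $w$ if every column is threaded and, for each $c$, the number of threads in column $c$ of $E$ equals the number of cells in column $c$ of $D(w)$. For such $E$, assign the threads of each column $c$ from north to south to the cells of $D(w)$ in column $c$ from north to south, and define the filling $\Xi_w(E):D(w)\to 2^{[n]}\setminus\{\varnothing\}$ by letting $\Xi_w(E)(r,c)$ be the set of row indices of the thread assigned to $(r,c)$. *)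

(* Defs.v *)
From HB Require Import structures.
From mathcomp Require Import all_boot all_fingroup.

Set Implicit Arguments.
Unset Strict Implicit.
Unset Printing Implicit Defensive.

(* Rows, columns and tableau entries range over 'I_n, that is over {0,..,n-1}
   rather than {1,..,n}.  Every condition below only compares indices with
   one another, so the shift by one changes nothing (in particular the flag
   condition "entry <= row index" is unaffected). *)

Definition cell (n : nat) : finType := ('I_n * 'I_n)%type.

Definition avoids1432 n (w : 'S_n) : Prop :=
  ~ exists j1 j2 j3 j4 : 'I_n,
      [/\ j1 < j2, j2 < j3 & j3 < j4] /\
      [/\ w j1 < w j4, w j4 < w j3 & w j3 < w j2].

Definition rothe n (w : 'S_n) : {set cell n} :=
  [set x : cell n | (x.1 < (w^-1)%g x.2) && (x.2 < w x.1)].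

Definition grave (n : nat) : finType :=
  {E : {set cell n} * {set cell n} | [disjoint E.1 & E.2]}.

Definition boxes n (E : grave n) : {set cell n} := (val E).1.
Definition ghosts n (E : grave n) : {set cell n} := (val E).2.
Definition occupied n (E : grave n) : {set cell n} := boxes E :|: ghosts E.

Definition grave_wt n (E : grave n) (i : 'I_n) : nat :=
  #|[set j : 'I_n | (i, j) \in occupied E]|.

Lemma disjoint_set0r n (A : {set cell n}) : [disjoint A & (set0 : {set cell n})].
Proof. by rewrite -setI_eq0 setI0. Qed.

Definition rothe_grave n (w : 'S_n) : grave n :=
  Sub (rothe w, set0) (disjoint_set0r (rothe w)).

(* The box (i, j) may move to (i', j). *)
Definition kohnert_allowed n (E : grave n) (i j i' : 'I_n) : bool :=
  [&& (i, j) \in boxes E,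
      [forall j' : 'I_n, ((i, j') \in occupied E) ==> (j' <= j)],
      (i' < i) && ((i', j) \notin occupied E),
      [forall r : 'I_n, ((r < i) && ((r, j) \notin occupied E)) ==> (r <= i')]
    & [forall r : 'I_n,
        [&& i' < r, r <= i & (r, j) \in occupied E] ==> ((r, j) \in boxes E)]].

Definition kohnert_move n (E E' : grave n) : bool :=
  [exists i : 'I_n, exists j : 'I_n, exists i' : 'I_n,
    [&& kohnert_allowed E i j i',
        boxes E' == (boxes E :\ (i, j)) :|: [set (i', j)]
      & ghosts E' == ghosts E]].

Definition K_kohnert_move n (E E' : grave n) : bool :=
  [exists i : 'I_n, exists j : 'I_n, exists i' : 'I_n,
    [&& kohnert_allowed E i j i',
        boxes E' == (boxes E :\ (i, j)) :|: [set (i', j)]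
      & ghosts E' == ghosts E :|: [set (i, j)]]].

Definition KKoh n (w : 'S_n) : {set grave n} :=
  [set E | connect (fun E1 E2 => kohnert_move E1 E2 || K_kohnert_move E1 E2)
             (rothe_grave w) E].

Definition nset (n : nat) : finType := {S : {set 'I_n} | S != set0}.

Lemma nset_ex n (S : nset n) : exists a, a \in val S.
Proof. exact/set0Pn/(valP S). Qed.

(* The default argument of arg min / arg max is an arbitrary element of S. *)
Definition smin n (S : nset n) : 'I_n :=
  [arg min_(a < xchoose (nset_ex S) in val S) (a : nat)].
Definition smax n (S : nset n) : 'I_n :=
  [arg max_(a > xchoose (nset_ex S) in val S) (a : nat)].

Definition rcell n (w : 'S_n) : finType := {x : cell n | x \in rothe w}.

Definition row n (w : 'S_n) (x : rcell w) : 'I_n := (val x).1.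
Definition col n (w : 'S_n) (x : rcell w) : 'I_n := (val x).2.

Definition filling n (w : 'S_n) : finType := {ffun rcell w -> nset n}.

Definition is_svrt n (w : 'S_n) (T : filling w) : bool :=
  [&& [forall x : rcell w, forall y : rcell w,
        ((row x == row y) && (col x < col y)) ==> (smax (T y) <= smin (T x))],
      [forall x : rcell w, forall y : rcell w,
        ((col x == col y) && (row x < row y)) ==> (smax (T x) < smin (T y))]
    & [forall x : rcell w, smax (T x) <= row x]].

Definition SVRT n (w : 'S_n) : finType := {T : filling w | is_svrt T}.

Definition svrt_wt n (w : 'S_n) (T : SVRT w) (i : 'I_n) : nat :=
  #|[set x : rcell w | i \in val (val T x)]|.

Definition Theta_boxes n (w : 'S_n) (T : filling w) : {set cell n} :=
  [set (smin (T x), col x) | x : rcell w].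

Definition Theta_ghosts n (w : 'S_n) (T : filling w) : {set cell n} :=
  [set y : cell n | [exists x : rcell w,
    [&& col x == y.2, y.1 \in val (T x) & smin (T x) < y.1]]].

Lemma smin_in n (S : nset n) : smin S \in val S.
Proof. by rewrite /smin; case: arg_minnP => //; exact: xchooseP. Qed.

Lemma smin_le n (S : nset n) a : a \in val S -> smin S <= a.
Proof.
by rewrite /smin; case: arg_minnP => [|i _ h /h //]; exact: xchooseP.
Qed.

Lemma smax_ge n (S : nset n) a : a \in val S -> a <= smax S.
Proof.
by rewrite /smax; case: arg_maxnP => [|i _ h /h //]; exact: xchooseP.
Qed.

Lemma Theta_disjoint n (w : 'S_n) (T : SVRT w) :
  [disjoint Theta_boxes (val T) & Theta_ghosts (val T)].
Proof.
have /and3P[_ /forallP hcol _] := valP T.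
rewrite -setI_eq0; apply/set0Pn => -[y /setIP[/imsetP[x _ ->]]].
rewrite inE /= => /existsP[z /and3P[/eqP czx xz ltzx]].
case: (ltngtP (row x) (row z)) => [lt|lt|/val_inj eq].
- have /forallP/(_ z) := hcol x; rewrite czx eqxx lt /= => h.
  have := leq_ltn_trans (smax_ge (smin_in (val T x))) (ltn_trans h ltzx).
  by rewrite ltnn.
- have /forallP/(_ x) := hcol z; rewrite czx eqxx lt /= => h.
  by have := leq_ltn_trans (smax_ge xz) h; rewrite ltnn.
- have exz : x = z.
    by apply: val_inj; rewrite [LHS]surjective_pairing [RHS]surjective_pairing;
       congr pair.
  by move: ltzx; rewrite exz ltnn.
Qed.

Definition Theta n (w : 'S_n) (T : SVRT w) : grave n :=
  Sub (Theta_boxes (val T), Theta_ghosts (val T)) (Theta_disjoint T).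

(* Rows met by A in column c, listed from north to south
   (enum 'I_n is increasing). *)
Definition column n (A : {set cell n}) (c : 'I_n) : seq 'I_n :=
  [seq r <- enum 'I_n | (r, c) \in A].

Definition threaded n (E : grave n) (c : 'I_n) : bool :=
  if column (occupied E) c is r :: _ then (r, c) \in boxes E else true.

(* Row indices of the thread whose box is (b, c). *)
Definition thread n (E : grave n) (c b : 'I_n) : {set 'I_n} :=
  b |: [set a : 'I_n |
         [&& (a, c) \in ghosts E, b < a
           & [forall b' : 'I_n, ((b < b') && ((b', c) \in boxes E)) ==> (a < b')]]].

Definition threads n (E : grave n) (c : 'I_n) : seq {set 'I_n} :=
  [seq thread E c b | b <- column (boxes E) c].

Definition thread_compatible n (w : 'S_n) (E : grave n) : bool :=
  [forall c : 'I_n, threaded E c] &&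
  [forall c : 'I_n, size (threads E c) == size (column (rothe w) c)].

(* The k-th cell of D(w) in column c receives the k-th thread of column c. *)
Definition Xi_set n (w : 'S_n) (E : grave n) (x : rcell w) : {set 'I_n} :=
  nth set0 (threads E (col x)) (index (row x) (column (rothe w) (col x))).

Lemma Xi_set_neq0 n (w : 'S_n) (E : grave n) (hE : thread_compatible w E)
  (x : rcell w) : Xi_set E x != set0.
Proof.
have /andP[_ /forallP/(_ (col x))/eqP hs] := hE.
have hx : row x \in column (rothe w) (col x).
  by rewrite mem_filter mem_enum andbT -surjective_pairing; exact: (valP x).
have hlt : index (row x) (column (rothe w) (col x)) < size (threads E (col x)).
  by rewrite hs index_mem.
have /mapP[b _ ->] : Xi_set E x \in threads E (col x) by exact: mem_nth.
by apply/set0Pn; exists b; rewrite setU11.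
Qed.

Definition Xi n (w : 'S_n) (E : grave n) (hE : thread_compatible w E) :
    filling w :=
  [ffun x : rcell w => (Sub (Xi_set E x) (Xi_set_neq0 hE x) : nset n)].

(* Main.v *)
(* Within a column, the entries of the cells of a tableau form consecutive
   threads of [Theta T], so reading off threads recovers [T].

   A Kohnert move on [Theta T] shifts a run of boxes in one column up by one,
   which is a change of the tableau.  The only condition that can fail is the
   row condition between a shifted cell and a cell to its right; a violation
   propagates down the run to the row of the moved box, contradicting that this
   box is rightmost, unless the run passes a 321 pattern of [w].  In that case
   1432-avoidance makes the column full above, hence with trivial entries, so
   that the run could not have moved.

   Conversely, in a tableau other than the one with entries [{row x}], take the
   lowest row with a cell whose minimum is above its row, and the leftmost such
   cell of this row.  Lowering this minimum by one row in the diagram is the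
   inverse of a move, so [Theta T] is reached by moves from [D(w)]. *)

Require Import Defs.
From mathcomp Require Import all_boot all_fingroup.
From mathcomp Require Import zify.

Set Implicit Arguments.
Unset Strict Implicit.
Unset Printing Implicit Defensive.

(** * Extrema of entry sets, and extensionality of grave diagrams *)

Lemma smax_in n (S : nset n) : smax S \in val S.
Proof. by rewrite /smax; case: arg_maxnP => //; exact: xchooseP. Qed.

Lemma smin_eq n (S : nset n) (a : 'I_n) :
  a \in val S -> (forall b, b \in val S -> a <= b) -> smin S = a.
Proof.
move=> aS amin; apply/val_inj/eqP.
by rewrite eqn_leq smin_le //= amin ?smin_in.
Qed.

(** Truncated at 0, but applied to positive indices, where it is the true predecessor. *)
Definition pred_ord n (v : 'I_n) : 'I_n :=
  Ordinal (leq_ltn_trans (leq_pred v) (ltn_ord v)).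

Lemma val_pred_ord n (v : 'I_n) : pred_ord v = v.-1 :> nat.
Proof. by []. Qed.

Lemma grave_ext n (E E' : grave n) :
  boxes E = boxes E' -> ghosts E = ghosts E' -> E = E'.
Proof.
rewrite /boxes /ghosts => eB eG; apply: val_inj.
by rewrite [LHS]surjective_pairing [RHS]surjective_pairing eB eG.
Qed.

(** * Tableaux, the occupied cells of their images, and weights *)

Section Fillings.

Variables (n : nat) (w : 'S_n).
Implicit Types (T : filling w) (x y z : rcell w) (a b c r : 'I_n).

Lemma rcell_ext x y : row x = row y -> col x = col y -> x = y.
Proof.
rewrite /row /col => er ec; apply: val_inj.
by rewrite [LHS]surjective_pairing [RHS]surjective_pairing er ec.
Qed.

Lemma row_colP x : (row x, col x) \in rothe w.
Proof. by rewrite -surjective_pairing; exact: (valP x). Qed.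

(** Comparing arbitrary entries instead of extrema lets a single changed entry be checked in
    isolation. *)
Lemma svrtP T :
  reflect [/\ forall x y a b, row x = row y -> col x < col y ->
                a \in val (T x) -> b \in val (T y) -> b <= a,
              forall x y a b, col x = col y -> row x < row y ->
                a \in val (T x) -> b \in val (T y) -> a < b
            & forall x a, a \in val (T x) -> a <= row x]
          (is_svrt T).
Proof.
apply: (iffP and3P) => [[/forallP hr /forallP hc /forallP hf]|[hr hc hf]];
  split.
- move=> x y a b e l ha hb; have /forallP/(_ y) := hr x.
  rewrite e eqxx l /= => h.
  by apply: leq_trans (smax_ge hb) (leq_trans h (smin_le ha)).
- move=> x y a b e l ha hb; have /forallP/(_ y) := hc x.
  rewrite e eqxx l /= => h.
  by apply: leq_ltn_trans (smax_ge ha) (leq_trans h (smin_le hb)).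
- by move=> x a ha; apply: leq_trans (smax_ge ha) (hf x).
- apply/forallP => x; apply/forallP => y; apply/implyP => /andP[/eqP e l].
  exact: hr (smin_in _) (smax_in _).
- apply/forallP => x; apply/forallP => y; apply/implyP => /andP[/eqP e l].
  exact: hc (smax_in _) (smin_in _).
- by apply/forallP => x; exact: hf (smax_in _).
Qed.

Lemma svrt_disjoint T x y a : is_svrt T -> col x = col y ->
  a \in val (T x) -> a \in val (T y) -> x = y.
Proof.
case/svrtP=> _ hc _ e ax ay; apply: rcell_ext => //.
case: (ltngtP (row x) (row y)) => [l|l|/val_inj //].
- by have := hc _ _ _ _ e l ax ay; rewrite ltnn.
- by have := hc _ _ _ _ (esym e) l ay ax; rewrite ltnn.
Qed.

Lemma svrt_smin_lt T x y : is_svrt T -> col x = col y ->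
  smin (T x) < smin (T y) -> row x < row y.
Proof.
move=> sT e l; case: (ltngtP (row x) (row y)) => [//|l'|/val_inj e'].
- have /svrtP[_ hc _] := sT.
  by have := hc _ _ _ _ (esym e) l' (smin_in _) (smin_in _); lia.
- by rewrite (rcell_ext e' e) ltnn in l.
Qed.

Lemma Theta_boxesP T a c :
  reflect (exists2 x, col x = c & smin (T x) = a) ((a, c) \in Theta_boxes T).
Proof.
apply: (iffP imsetP) => [[x _ [-> ->]]|[x <- <-]]; first by exists x.
by exists x.
Qed.

Lemma Theta_ghostsP T a c :
  reflect (exists x, [/\ col x = c, a \in val (T x) & smin (T x) < a])
          ((a, c) \in Theta_ghosts T).
Proof.
rewrite inE; apply: (iffP existsP) => -[x] /=.
- by case/and3P=> /eqP ? ? ?; exists x.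
- by case=> /eqP ? ? ?; exists x; apply/and3P.
Qed.

Lemma Theta_occupiedP (T : SVRT w) a c :
  reflect (exists2 x, col x = c & a \in val (val T x))
          ((a, c) \in occupied (Theta T)).
Proof.
rewrite inE; apply: (iffP orP) => [[/Theta_boxesP[x e <-]|/Theta_ghostsP[x []]]|
  [x e ax]].
- by exists x => //; exact: smin_in.
- by exists x.
- have := smin_le ax; rewrite leq_eqVlt => /orP[/eqP/val_inj eq|l].
  + by left; apply/Theta_boxesP; exists x.
  + by right; apply/Theta_ghostsP; exists x.
Qed.

Lemma grave_wt_Theta (T : SVRT w) i : grave_wt (Theta T) i = svrt_wt T i.
Proof.
(* Cells of one column share no entry, so [col] is injective on the cells containing [i]. *)
rewrite /grave_wt /svrt_wt -[RHS](@card_in_imset _ _ (@col n w)); last first.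
  by move=> x y; rewrite !inE => ix iy e; exact: svrt_disjoint (valP T) e ix iy.
apply: eq_card => c; rewrite inE.
apply/Theta_occupiedP/imsetP => -[x].
- by move=> <- ix; exists x; rewrite ?inE.
- by rewrite inE => ix ->; exists x.
Qed.

(** * Columns and threads: [Xi] recovers a tableau from its image *)

Lemma mem_column (A : {set cell n}) c r : (r \in column A c) = ((r, c) \in A).
Proof. by rewrite mem_filter mem_enum andbT. Qed.

Lemma column_sorted (A : {set cell n}) c :
  sorted (fun a b : 'I_n => a < b) (column A c).
Proof.
apply: sorted_filter; first by move=> ? ? ?; exact: ltn_trans.
by have := iota_ltn_sorted 0 n; rewrite -val_enum_ord sorted_map.
Qed.

(** A ghost of a lower cell of the column is cut off by the box of that cell, and a ghost of a
    higher cell lies above the box of [x]. *)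
Lemma thread_Theta (T : SVRT w) x :
  thread (Theta T) (col x) (smin (val T x)) = val (val T x).
Proof.
have sT := valP T; have /svrtP[_ hc _] := sT.
apply/setP => a; rewrite in_setU1 in_set; apply/orP/idP.
- case=> [/eqP->|/and3P[/Theta_ghostsP[y [e ay lya]] lxa /forallP hb]].
    exact: smin_in.
  case: (ltngtP (row x) (row y)) => [l|l|/val_inj e'].
  + have := hc _ _ _ _ (esym e) l (smin_in _) (smin_in _) => lxy.
    have := hb (smin (val T y)); rewrite lxy /=.
    have -> /= : (smin (val T y), col x) \in boxes (Theta T).
      by apply/Theta_boxesP; exists y.
    by move=> /ltn_trans/(_ lya); rewrite ltnn.
  + by have := hc _ _ _ _ e l ay (smin_in _); lia.
  + by rewrite (rcell_ext e' (esym e)).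
- move=> ax; have := smin_le ax; rewrite leq_eqVlt => /orP[/eqP/val_inj->|l].
    by left.
  right; apply/and3P; split=> //; first by apply/Theta_ghostsP; exists x.
  apply/forallP => b; apply/implyP => /andP[lb /Theta_boxesP[y e eb]].
  have lr : row x < row y by apply: (svrt_smin_lt sT (esym e)); rewrite eb.
  by rewrite -eb; exact: hc (esym e) lr ax (smin_in _).
Qed.

(** Made total in [r], with default [r] off the diagram, so that it can be mapped over
    [column (rothe w) c]. *)
Definition row_smin T c r : 'I_n :=
  if insub (r, c) is Some x then smin (T x) else r.

Lemma row_sminE T x : row_smin T (col x) (row x) = smin (T x).
Proof. by rewrite /row_smin -surjective_pairing valK. Qed.

Lemma rcell_of r c : (r, c) \in rothe w ->
  exists x : rcell w, row x = r /\ col x = c.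
Proof. by move=> h; exists (Sub (r, c) h). Qed.

(** Both lists are strictly increasing with the same members. Hence the k-th box of the column
    belongs to the k-th cell of D(w), which is how [Xi] assigns threads. *)
Lemma column_Theta_boxes T c : is_svrt T ->
  column (Theta_boxes T) c = map (row_smin T c) (column (rothe w) c).
Proof.
move=> sT; have /svrtP[_ hc _] := sT.
apply: (@irr_sorted_eq _ (fun a b : 'I_n => a < b)).
- by move=> ? ? ?; exact: ltn_trans.
- by move=> ?; exact: ltnn.
- exact: column_sorted.
- have mono : {in column (rothe w) c &,
      {homo row_smin T c : a b / a < b >-> a < b}}.
    move=> a b; rewrite !mem_column => /rcell_of[x [<- e]] /rcell_of[y [<- e']].
    rewrite -{1}e -{1}e' !row_sminE => l.
    by apply: hc l (smin_in _) (smin_in _); rewrite e.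
  apply: (homo_sorted_in mono); last exact: column_sorted.
  by apply/allP.
- move=> a; rewrite mem_column; apply/Theta_boxesP/mapP.
  + case=> x <- <-; exists (row x); last by rewrite row_sminE.
    by rewrite mem_column row_colP.
  + case=> r; rewrite mem_column => /rcell_of[x [<- <-]] ->.
    by exists x; rewrite ?row_sminE.
Qed.

Lemma Theta_thread_compatible (T : SVRT w) : thread_compatible w (Theta T).
Proof.
apply/andP; split; apply/forallP => c; last first.
  by rewrite size_map (column_Theta_boxes _ (valP T)) size_map.
rewrite /threaded; case ec: (column _ c) => [//|r s].
have : r \in column (occupied (Theta T)) c by rewrite ec inE eqxx.
rewrite mem_column => /Theta_occupiedP[x e rx].
(* The minimum of the cell containing the topmost row [r] is occupied and at most [r], hence it is
   [r]. *)
have : smin (val T x) \in column (occupied (Theta T)) c.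
  by rewrite mem_column; apply/Theta_occupiedP; exists x => //; exact: smin_in.
rewrite ec inE => /orP[/eqP <-|]; first by apply/Theta_boxesP; exists x.
have := column_sorted (occupied (Theta T)) c; rewrite ec /= => h.
have tr : transitive (fun a b : 'I_n => a < b) by move=> ? ? ?; exact: ltn_trans.
move: h; rewrite (path_sortedE tr) => /andP[/allP h _] /h.
by rewrite ltnNge smin_le.
Qed.

Lemma Xi_Theta (T : SVRT w) (hE : thread_compatible w (Theta T)) :
  Xi hE = val T.
Proof.
apply/ffunP => x; rewrite ffunE; apply: val_inj; rewrite SubK /Xi_set /threads.
have mx : row x \in column (rothe w) (col x) by rewrite mem_column row_colP.
rewrite /boxes /= (column_Theta_boxes _ (valP T)) -map_comp.
rewrite (nth_map (row x)) ?index_mem // nth_index //= row_sminE.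
exact: thread_Theta.
Qed.

Lemma Theta_inj : injective (@Theta n w).
Proof.
move=> T T' e; apply: val_inj.
rewrite -(Xi_Theta (Theta_thread_compatible T)).
by move: (Theta_thread_compatible T); rewrite e => h; rewrite Xi_Theta.
Qed.

(* The hypotheses give a 321 pattern in [w] starting at position [r] with last
   value [c], so a value below [c] at a position before [r] would make a 1432. *)
Lemma avoid_full (hw : avoids1432 w) r r' c c' (q : 'I_n) :
  (r, c) \in rothe w -> (r, c') \in rothe w -> (r', c) \in rothe w ->
  c < c' -> r < r' -> (r', c') \notin rothe w -> q <= r -> (q, c) \in rothe w.
Proof.
rewrite !inE /= => /andP[h1 h2] /andP[h3 h4] /andP[h5 h6] lc lr hn lq.
have hlt := leq_ltn_trans lq h1; rewrite hlt /= ltnNge; apply/negP => hq.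
have eK u : w ((w^-1)%g u) = u by rewrite permKV.
have {hq} hq : w q < c.
  rewrite ltn_neqAle hq andbT; apply/negP => /eqP/val_inj e.
  by move: hlt; rewrite -e permK ltnn.
have {lq} lq : q < r.
  rewrite ltn_neqAle lq andbT; apply/negP => /eqP/val_inj e.
  by move: h2 hq; rewrite e; lia.
(* Either [c'] occurs at a position up to [r'], or [w r' <= c']; the value playing 3 in the 1432
   pattern is [c'] or [w r'] accordingly. *)
apply: hw; move: hn; rewrite negb_and -!leqNgt => /orP[hn|hn].
- exists q, r, ((w^-1)%g c'), ((w^-1)%g c); rewrite !eK.
  by split; split=> //; lia.
- exists q, r, r', ((w^-1)%g c); rewrite !eK.
  by split; split=> //; lia.
Qed.

(** Entries increase strictly down a column without gaps, so those in row r, counted from 0, are at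
    least r; the flag condition bounds them by r. *)
Lemma full_column_trivial (S : filling w) (sS : is_svrt S) x a :
  (forall q : 'I_n, q <= row x -> (q, col x) \in rothe w) ->
  a \in val (S x) -> a = row x.
Proof.
have /svrtP[_ hc hf] := sS => full ax; apply/val_inj/eqP.
rewrite eqn_leq hf //=.
have [m] := ubnP (row x); elim: m x a full ax => // m IH x a full ax lm.
case: (posnP (row x)) => [->//|p0].
have hp : pred_ord (row x) < row x by rewrite /=; lia.
have [y [ey ec]] := rcell_of (full _ (ltnW hp)).
have lyx : row y < row x by rewrite ey.
have : row y <= smin (S y).
  apply: IH (smin_in _) _; last by lia.
  by rewrite ec => q lq; apply: full; lia.
have := hc _ _ _ _ ec lyx (smin_in _) ax.
by rewrite ey /=; lia.
Qed.

End Fillings.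

(** * Kohnert moves as operations on tableaux *)

Section Lower.

Variables (n : nat) (w : 'S_n) (T : filling w) (sT : is_svrt T).
Variables (i j i' : 'I_n) (K : bool).

Local Notation E := (Theta (exist _ T sT : SVRT w)).

Hypothesis allowed : kohnert_allowed E i j i'.
Implicit Types (x y z : rcell w) (a b c r : 'I_n).

Definition lowered x := (col x == j) && (i' < smin (T x) <= i).

(** In a K-move the cell with minimum [i] keeps [i], which thereby becomes a ghost. *)
Definition lower_set x : {set 'I_n} :=
  if lowered x then
    pred_ord (smin (T x)) |:
      (if K && (smin (T x) == i) then val (T x)
       else val (T x) :\ smin (T x))
  else val (T x).

Lemma lower_neq0 x : lower_set x != set0.
Proof.
rewrite /lower_set; case: ifP => _; last exact: (valP (T x)).
by apply/set0Pn; exists (pred_ord (smin (T x))); rewrite setU11.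
Qed.

(* A move of the box (i, j) up to (i', j) across a run of boxes is read as
   shifting every box of the run up by one. *)
Definition lower : filling w :=
  [ffun x => (Sub (lower_set x) (lower_neq0 x) : nset n)].

Lemma val_lower x : val (lower x) = lower_set x.
Proof. by rewrite ffunE SubK. Qed.

Lemma allowed_lt : i' < i.
Proof. by case/and5P: allowed => _ _ /andP[]. Qed.

Lemma allowed_empty x : col x = j -> i' \notin val (T x).
Proof.
move=> e; case/and5P: allowed => _ _ /andP[_ h] _ _.
by apply: contra h => h; apply/Theta_occupiedP; exists x.
Qed.

Lemma allowed_right x : i \in val (T x) -> col x <= j.
Proof.
move=> ix; case/and5P: allowed => _ /forallP/(_ (col x))/implyP h _ _ _.
by apply: h; apply/Theta_occupiedP; exists x.
Qed.

(** Since [i'] is the last empty row above [i], the rows between are occupied, and then by boxes.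
    Taking [r] in [nat] allows successors and predecessors of minima. *)
Lemma allowed_box (r : nat) : i' < r <= i ->
  exists2 x, col x = j & smin (T x) = r :> nat.
Proof.
case/andP=> l1 l2; have [r' er] : exists r' : 'I_n, r' = r :> nat.
  by exists (Ordinal (leq_ltn_trans l2 (ltn_ord i))).
rewrite -{r}er in l1 l2 *.
suff /Theta_boxesP[x ex sx] : (r', j) \in boxes E by exists x; rewrite ?sx.
case/and5P: allowed => hb _ _ /forallP/(_ r') h1 /forallP/(_ r') h2.
move: l2; rewrite leq_eqVlt => /orP[/eqP/val_inj->//|l2].
move: h2; rewrite l1 (ltnW l2) /= => /implyP; apply.
by move: h1; rewrite l2 /= leqNgt l1 implybF => /negPn.
Qed.

Lemma smin_lower x : smin (lower x) =
  if lowered x then pred_ord (smin (T x)) else smin (T x).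
Proof.
apply: smin_eq; rewrite val_lower /lower_set; case: ifP => // _.
- by rewrite setU11.
- exact: smin_in.
- move=> b; rewrite in_setU1 => /orP[/eqP->//|h].
  have {}h : b \in val (T x).
    by move: h; case: ifP => // _; rewrite in_setD1 => /andP[].
  exact: leq_trans (leq_pred _) (smin_le h).
- by move=> b; exact: smin_le.
Qed.

Lemma mem_lower x a : a \in val (lower x) ->
  a \in val (T x) \/ lowered x /\ a = pred_ord (smin (T x)).
Proof.
rewrite val_lower /lower_set; case: ifP => l; last by left.
rewrite in_setU1 => /orP[/eqP->|]; first by right.
by case: ifP => _; rewrite ?in_setD1 => h; left => //; case/andP: h.
Qed.

(** Shifting the run in rows i'+1, ..., i up by one fills rows i', ..., i-1: as a set, only (i, j)
    is lost and only (i', j) gained. *)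
Lemma boxes_lower :
  Theta_boxes lower = boxes E :\ (i, j) :|: [set (i', j)].
Proof.
have lt := allowed_lt.
apply/setP => -[a c]; rewrite !inE !xpair_eqE.
apply/Theta_boxesP/orP.
- case=> x ex <-; rewrite smin_lower; case: ifP.
  + case/andP=> /eqP ej /andP[l1 l2]; rewrite -ex ej eqxx !andbT.
    case: (eqVneq (pred_ord (smin (T x))) i') => [_|ne]; first by right.
    have {}ne : (smin (T x)).-1 <> i'.
      by rewrite -val_pred_ord => /val_inj; exact/eqP.
    left; apply/andP; split.
      by apply/eqP => /(congr1 (@nat_of_ord n)); rewrite !val_pred_ord; lia.
    apply/Theta_boxesP; have [|y ey sy] := @allowed_box (smin (T x)).-1.
      by lia.
    by exists y => //; apply: val_inj.
  + move=> h; left; apply/andP; split; last by apply/Theta_boxesP; exists x.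
    apply/negP => /andP[/eqP e /eqP ec]; move: h.
    by rewrite /lowered ex ec eqxx e lt leqnn.
- case=> [/andP[ne /Theta_boxesP[x ex ea]]|/andP[/eqP-> /eqP->]].
  + case lx: (lowered x); last by exists x; rewrite // smin_lower lx.
    case/andP: lx => /eqP ej; rewrite ea => /andP[l1 l2].
    have {}l2 : a < i.
      rewrite ltn_neqAle l2 andbT; apply: contra ne => /eqP/val_inj->.
      by rewrite -ex ej !eqxx.
    (* Row [a] of the run is refilled by the box from the row below it. *)
    have [|y ey sy] := @allowed_box a.+1; first by lia.
    exists y; first by rewrite ey -ej.
    rewrite smin_lower /lowered ey eqxx sy l2 ltnS (ltnW l1).
    by apply: ord_inj; rewrite !val_pred_ord sy.
  + have [|y ey sy] := @allowed_box i'.+1; first by lia.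
    exists y => //; rewrite smin_lower /lowered ey eqxx sy ltnSn lt.
    by apply: ord_inj; rewrite !val_pred_ord sy.
Qed.

Lemma ghosts_lower : Theta_ghosts lower =
  ghosts E :|: (if K then [set (i, j)] else set0).
Proof.
have lt := allowed_lt.
apply/setP => -[a c]; rewrite in_setU; apply/Theta_ghostsP/orP.
- case=> x []; rewrite val_lower /lower_set smin_lower.
  case: ifP => lx ex; last by left; apply/Theta_ghostsP; exists x.
  rewrite in_setU1 => /orP[/eqP->|]; first by rewrite ltnn.
  case: ifP => [/andP[hK /eqP ei] ax _|_].
  + case/andP: lx => /eqP ej _.
    case: (eqVneq a i) => [->|ne]; first by right; rewrite hK inE -ex ej.
    left; apply/Theta_ghostsP; exists x; split=> //.
    rewrite ltn_neqAle smin_le // andbT ei.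
    by apply: contra ne => /eqP/val_inj->.
  + rewrite in_setD1 => /andP[ne ax] _; left; apply/Theta_ghostsP.
    exists x; split=> //; rewrite ltn_neqAle smin_le // andbT.
    by apply: contra ne => /eqP/val_inj->.
- case=> [/Theta_ghostsP[x [ex ax l]]|].
  + exists x; split=> //; rewrite ?val_lower /lower_set ?smin_lower;
      case: ifP => // _.
    * rewrite in_setU1; apply/orP; right; case: ifP => // _.
      by rewrite in_setD1 ax andbT; apply: contraTneq l => ->; rewrite ltnn.
    * exact: leq_ltn_trans (leq_pred _) l.
  + case hK: K; rewrite inE // => /eqP[-> ->].
    have [|x ex /val_inj sx] := @allowed_box i; first by rewrite lt leqnn.
    have lx : lowered x by rewrite /lowered ex sx eqxx lt leqnn.
    exists x; split=> //; rewrite ?val_lower /lower_set ?smin_lower lx sx.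
    * by rewrite hK eqxx in_setU1 -[X in X \in _]sx smin_in orbT.
    * by rewrite !val_pred_ord; lia.
Qed.

(** [E'] is described by its cells because [lower] need not yet be known to be a tableau;
    [raise_move] uses this with [lower] equal to a given tableau. *)
Lemma lower_move (E' : grave n) :
  boxes E' = Theta_boxes lower -> ghosts E' = Theta_ghosts lower ->
  kohnert_move E E' || K_kohnert_move E E'.
Proof.
move=> eB eG; apply/orP; have := ghosts_lower; case hK: K => eg; [right|left];
  apply/existsP; exists i; apply/existsP; exists j; apply/existsP; exists i';
  rewrite allowed eB eG boxes_lower eg ?setU0 !eqxx //.
Qed.

(** Entries of [y] are at most the minimum of [x] already, so excluding equality is exactly what the
    lowered minimum requires. Induction runs down the run, towards row [i]. *)
Lemma lowered_right_notin (hw : avoids1432 w) x y : lowered x ->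
  row x = row y -> col x < col y -> smin (T x) \notin val (T y).
Proof.
have /svrtP[hr hc hf] := sT.
have [m] := ubnP (i - smin (T x)).
elim: m x y => // m IH x y lm /andP[/eqP ej /andP[l1 l2]] er lc.
apply/negP => vy; move: l2; rewrite leq_eqVlt => /orP[/eqP/val_inj e|l2].
  by rewrite e in vy; have := allowed_right vy; rewrite -ej leqNgt lc.
have [|x' ex sx] := @allowed_box (smin (T x)).+1; first by lia.
have exx : col x = col x' by rewrite ej ex.
have lrx : row x < row x' by apply: (svrt_smin_lt sT exx); rewrite sx.
(* If [y'] exists, its minimum exceeds that of [x] and is at most that of [x'], which is one more;
   so it equals the latter and the violation moves on to [x'] and [y']. *)
case: (boolP ((row x', col y) \in rothe w)) => [/rcell_of[y' [ey ec]]|hnin].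
- have ly' : row y < row y' by rewrite ey -er.
  have lc' : col x' < col y' by rewrite ec -exx.
  have lv := hc _ _ _ _ (esym ec) ly' vy (smin_in _).
  have lv' := hr _ _ _ _ (esym ey) lc' (smin_in _) (smin_in _).
  suff : smin (T x') \notin val (T y').
    suff -> : smin (T x') = smin (T y') by rewrite smin_in.
    by apply: ord_inj; lia.
  apply: IH => //; last by rewrite /lowered ex eqxx; lia.
  by lia.
(* The missing cell makes column [j] full down to row [x]. Its cell in row [i'] then has the entry
   [i'], but (i', j) is unoccupied. *)
- have li : i' <= row x by have := hf _ _ (smin_in (T x)); lia.
  have h1 := row_colP x; have h2 := row_colP y; have h3 := row_colP x'.
  rewrite -er in h2; rewrite -exx in h3.
  have full q := avoid_full hw h1 h2 h3 lc lrx hnin (q := q).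
  have [z [ez ecz]] := rcell_of (full _ li).
  have : smin (T z) = row z.
    apply: (full_column_trivial sT _ (smin_in _)).
    by rewrite ez ecz => q lq; apply: full; lia.
  rewrite ez => e; have := allowed_empty (etrans ecz ej).
  by rewrite -e smin_in.
Qed.

Lemma lower_svrt : avoids1432 w -> is_svrt lower.
Proof.
move=> hw; have /svrtP[hr hc hf] := sT.
(* Entries only decrease, so a bound from above on an entry survives; the cases below treat bounds
   from below on a lowered minimum. *)
have low x a : a \in val (lower x) -> exists2 a', a' \in val (T x) & a <= a'.
  case/mem_lower => [ax|[_ ->]]; first by exists a.
  by exists (smin (T x)); rewrite ?smin_in ?leq_pred.
apply/svrtP; split.
- move=> x y a b er lc ax bny; have [b' by' lb] := low _ _ bny.
  apply: leq_trans lb _; have h v : v \in val (T x) -> b' <= v.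
    by move=> vx; exact: hr er lc vx by'.
  case/mem_lower: ax => [|[lx ->]]; first exact: h.
  have := lowered_right_notin hw lx er lc; have := h _ (smin_in _) => l ne.
  suff : b' < smin (T x) by rewrite !val_pred_ord; lia.
  by rewrite ltn_neqAle l andbT; apply: contra ne => /eqP/val_inj <-.
- move=> x y a b ec lr ax /mem_lower[bny|[ly ->]].
    have [a' ax' la] := low _ _ ax.
    exact: leq_ltn_trans la (hc _ _ _ _ ec lr ax' bny).
  have lv a' : a' \in val (T x) -> a' < smin (T y).
    by move=> ax'; exact: hc ec lr ax' (smin_in _).
  have/andP[/eqP ey /andP[l1 l2]] := ly.
  case/mem_lower: (ax) => [ax'|[lx ->]]; last first.
    have/andP[_ /andP[l3 _]] := lx.
    by have := lv _ (smin_in _); rewrite !val_pred_ord; lia.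
  have := lv _ ax' => la; rewrite ltn_neqAle; apply/andP; split; last first.
    by rewrite !val_pred_ord; lia.
  (* Suppose the new minimum of [y] is an entry [a] of [x]. As [i'] is empty, [a] lies in the run,
     so it is the minimum of [x] and [x] is lowered too. Then [a] is dropped, unless [a] is [i],
     which the minimum of [y] being at most [i] forbids. *)
  apply/negP => /eqP/val_inj e.
  have li : i' < a.
    have ne : a <> i' :> nat.
      move=> /val_inj e'; have := allowed_empty (etrans ec ey).
      by rewrite -e' ax'.
    by have := congr1 (@nat_of_ord n) e; rewrite val_pred_ord; lia.
  have [|z ez /val_inj sz] := @allowed_box a; first by lia.
  have exz : z = x.
    apply: (svrt_disjoint sT _ _ ax'); first by rewrite ez ec ey.
    by rewrite -sz smin_in.
  subst z; have lx : lowered x by rewrite /lowered ez eqxx sz li; lia.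
  move: ax; rewrite val_lower /lower_set lx sz in_setU1.
  case/orP=> [/eqP/(congr1 (@nat_of_ord n))|].
    by rewrite !val_pred_ord; lia.
  case: ifP => [/andP[_ /eqP ei] _|_]; last by rewrite in_setD1 eqxx.
  by move: la l2; rewrite ei; lia.
- by move=> x a /low[a' /hf h1 h2]; exact: leq_trans h2 h1.
Qed.

End Lower.

(** * Undoing a move at a suitably chosen cell *)

Section Raise.

Variables (n : nat) (w : 'S_n) (T : filling w) (sT : is_svrt T) (x : rcell w).
Implicit Types (y z : rcell w) (a : 'I_n).

Hypothesis x_high : smin (T x) < row x.
Hypothesis below_fixed : forall y, row x < row y -> smin (T y) = row y.
Hypothesis left_fixed :
  forall y, row y = row x -> col y < col x -> smin (T y) = row y.

Definition next : 'I_n := Ordinal (leq_ltn_trans x_high (ltn_ord (row x))).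

Lemma val_next : next = (smin (T x)).+1 :> nat.
Proof. by []. Qed.

(** If [next] is already an entry of [x], the union absorbs it and only the minimum is lost; this
    case undoes a K-move. *)
Definition raise_set y : {set 'I_n} :=
  if y == x then next |: (val (T x) :\ smin (T x)) else val (T y).

Lemma raise_neq0 y : raise_set y != set0.
Proof.
rewrite /raise_set; case: ifP => _; last exact: (valP (T y)).
by apply/set0Pn; exists next; rewrite setU11.
Qed.

Definition raise : filling w :=
  [ffun y => (Sub (raise_set y) (raise_neq0 y) : nset n)].

Lemma val_raise y : val (raise y) = raise_set y.
Proof. by rewrite ffunE SubK. Qed.

Lemma raise_other y : y != x -> raise y = T y.
Proof.
by move=> ne; apply: val_inj; rewrite val_raise /raise_set (negPf ne).
Qed.

Lemma mem_raise_gt a : a \in val (raise x) -> smin (T x) < a.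
Proof.
rewrite val_raise /raise_set eqxx in_setU1 => /orP[/eqP->|].
  by rewrite val_next.
rewrite in_setD1 => /andP[ne ax]; rewrite ltn_neqAle smin_le // andbT.
by apply: contra ne => /eqP/val_inj->.
Qed.

Lemma next_raise : next \in val (raise x).
Proof. by rewrite val_raise /raise_set eqxx setU11. Qed.

Lemma smin_raise : smin (raise x) = next.
Proof.
by apply: smin_eq next_raise _ => a /mem_raise_gt; rewrite val_next.
Qed.

Lemma raise_flag y a : a \in val (raise y) -> a <= row y.
Proof.
have /svrtP[_ _ hf] := sT.
case: (eqVneq y x) => [->|ne]; last by rewrite raise_other //; exact: hf.
rewrite val_raise /raise_set eqxx in_setU1 => /orP[/eqP->|].
  by rewrite val_next.
by rewrite in_setD1 => /andP[_]; exact: hf.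
Qed.

Lemma fixed_entry y a : smin (T y) = row y -> a \in val (T y) -> a = row y.
Proof.
have /svrtP[_ _ hf] := sT => e ay; apply/val_inj/eqP.
by rewrite eqn_leq hf //= -e smin_le.
Qed.

(** Raising can only break comparisons with cells to the left in the row or below in the column.
    Those cells have their row index as sole entry, and the flag condition at [x] suffices. *)
Lemma raise_svrt : is_svrt raise.
Proof.
have /svrtP[hr hc hf] := sT; apply/svrtP; split.
- move=> y z a b er lc ay bz; case: (eqVneq z x) => [ez|nz].
    subst z; have ne : y != x by apply: contraTneq lc => ->; rewrite ltnn.
    rewrite raise_other // in ay.
    by rewrite (fixed_entry (left_fixed er lc) ay) er raise_flag.
  rewrite raise_other // in bz; case: (eqVneq y x) => [ey|ny].
    subst y; apply: leq_trans (ltnW (mem_raise_gt ay)).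
    exact: hr er lc (smin_in _) bz.
  by rewrite raise_other // in ay; exact: hr er lc ay bz.
- move=> y z a b ec lr ay bz; case: (eqVneq y x) => [ey|ny].
    subst y; have ne : z != x by apply: contraTneq lr => ->; rewrite ltnn.
    rewrite raise_other // in bz.
    rewrite (fixed_entry (below_fixed lr) bz).
    exact: leq_ltn_trans (raise_flag ay) lr.
  rewrite raise_other // in ay; case: (eqVneq z x) => [ez|nz].
    subst z; apply: ltn_trans (mem_raise_gt bz).
    exact: hc ec lr ay (smin_in _).
  by rewrite raise_other // in bz; exact: hc ec lr ay bz.
- exact: raise_flag.
Qed.

Local Notation E := (Theta (exist _ raise raise_svrt : SVRT w)).

Lemma raise_right y : next \in val (raise y) -> col y <= col x.
Proof.
have /svrtP[hr hc _] := sT; move=> hy; rewrite leqNgt; apply/negP => lc.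
have ne : y != x by apply: contraTneq lc => ->; rewrite ltnn.
rewrite raise_other // in hy.
case: (ltngtP (row x) (row y)) => [l|l|/val_inj e].
- have := fixed_entry (below_fixed l) hy => /(congr1 (@nat_of_ord n)).
  by rewrite val_next; lia.
(* A Rothe diagram contains the cell in the row of [y] and the column of [x]. Its minimum is below
   that of [x] by the column condition, yet at least [next] by the row condition. *)
- case: (boolP ((row y, col x) \in rothe w)) => [/rcell_of[z [ez ec]]|hn].
  + have lz : row z < row x by rewrite ez.
    have lcz : col z < col y by rewrite ec.
    have := hr _ _ _ _ ez lcz (smin_in _) hy.
    have := hc _ _ _ _ ec lz (smin_in _) (smin_in _).
    by rewrite val_next; lia.
  + move: hn (row_colP y) (row_colP x); rewrite !inE /=; lia.
- have := hr _ _ _ _ e lc (smin_in _) hy.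
  by rewrite val_next ltnn.
Qed.

Lemma raise_allowed : kohnert_allowed E next (col x) (smin (T x)).
Proof.
apply/and5P; split.
- by apply/Theta_boxesP; exists x => //; exact: smin_raise.
- apply/forallP => c; apply/implyP => /Theta_occupiedP[y <-].
  exact: raise_right.
- rewrite val_next ltnSn /=; apply/Theta_occupiedP => -[y ec].
  case: (eqVneq y x) => [->|ne] /=; first by move/mem_raise_gt; rewrite ltnn.
  rewrite raise_other // => hy; move: ne.
  by rewrite (svrt_disjoint sT ec hy (smin_in _)) eqxx.
- by apply/forallP => r; apply/implyP => /andP[].
- apply/forallP => r; apply/implyP => /and3P[l1 l2 _].
  have -> : r = next by apply: ord_inj; move: l1 l2; rewrite val_next; lia.
  by apply/Theta_boxesP; exists x => //; exact: smin_raise.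
Qed.

(** The run is the single box at [next]. The flag [K] records whether [next] was an entry of [x]
    before raising, that is, whether the move leaves a ghost there. *)
Lemma lower_raise :
  lower raise next (col x) (smin (T x)) (next \in val (T x)) = T.
Proof.
apply/ffunP => y; apply: val_inj; rewrite val_lower /lower_set.
have -> : lowered raise next (col x) (smin (T x)) y = (y == x).
  rewrite /lowered; apply/idP/eqP => [/and3P[/eqP ec l1 l2]|->]; last first.
    by rewrite smin_raise val_next eqxx ltnSn.
  have e : smin (raise y) = next.
    by apply: ord_inj; move: l1 l2; rewrite val_next; lia.
  apply: (svrt_disjoint raise_svrt ec _ next_raise).
  by rewrite -e smin_in.
case: (eqVneq y x) => [->|ne]; last by rewrite raise_other.
have e : pred_ord next = smin (T x).
  by apply: ord_inj; rewrite val_pred_ord val_next.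
have nb : (smin (T x) == next) = false.
  by apply/eqP => /(congr1 (@nat_of_ord n)); rewrite val_next; lia.
rewrite smin_raise e eqxx andbT val_raise /raise_set eqxx.
apply/setP => a; rewrite in_setU1.
case: (eqVneq a (smin (T x))) => [->|na]; first by rewrite smin_in.
case: ifP => hn; rewrite !inE na //=.
- by case: (eqVneq a next) => [->|].
- by case: (eqVneq a next) => [->|].
Qed.

Lemma raise_move :
  kohnert_move E (Theta (exist _ T sT : SVRT w)) ||
  K_kohnert_move E (Theta (exist _ T sT : SVRT w)).
Proof.
by apply: (lower_move (K := next \in val (T x)) raise_allowed);
  rewrite lower_raise.
Qed.

Lemma raise_measure :
  \sum_y (n - smin (raise y)) < \sum_y (n - smin (T y)).
Proof.
rewrite (bigD1 x) //= [X in _ < X](bigD1 x) //=.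
rewrite (eq_bigr (fun y => n - smin (T y))); last by move=> y /raise_other->.
rewrite ltn_add2r smin_raise val_next.
exact: ltn_sub2l (ltn_ord _) (ltnSn _).
Qed.

End Raise.

(** * The image of [Theta] is the closure under moves *)

Section Closure.

Variables (n : nat) (w : 'S_n).

Let moves (E1 E2 : grave n) := kohnert_move E1 E2 || K_kohnert_move E1 E2.

Lemma fixed_Theta (T : SVRT w) :
  (forall x, smin (val T x) = row x) -> Theta T = rothe_grave w.
Proof.
have /svrtP[_ _ hf] := valP T => h; apply: grave_ext; apply/setP => -[a c].
- apply/Theta_boxesP/idP => [[x <- <-]|/rcell_of[x [<- <-]]].
    by rewrite h row_colP.
  by exists x.
- rewrite [RHS]inE; apply/negP => /Theta_ghostsP[x [_ /hf l]].
  by rewrite h ltnNge l.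
Qed.

(** Raising decreases the sum of [n - smin (T x)], so by induction the raised tableau is reachable,
    and one move leads from it to [T]. *)
Lemma Theta_in_KKoh (T : SVRT w) : Theta T \in KKoh w.
Proof.
rewrite inE; case: T => T sT.
have [m] := ubnP (\sum_x (n - smin (T x))); elim: m T sT => // m IH T sT lm.
pose high x := smin (T x) < row x.
have /svrtP[_ _ hf] := sT.
have high0 x : ~~ high x -> smin (T x) = row x.
  move=> h; apply: ord_inj; apply/eqP; rewrite eqn_leq hf ?smin_in //.
  by rewrite leqNgt.
case: (pickP high) => [x0 h0|none]; last first.
  by rewrite fixed_Theta // => x; rewrite high0 // none.
have [x1 h1 max1] := arg_maxnP (fun x => row x : nat) h0.
pose high1 x := high x && (row x == row x1).
have h11 : high1 x1 by rewrite /high1 h1 eqxx.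
have [x /andP[hx /eqP ex] minx] := arg_minnP (fun x => col x : nat) h11.
have below y : row x < row y -> smin (T y) = row y.
  move=> l; apply: high0; apply/negP => /max1.
  by rewrite -ex /= leqNgt l.
have left y : row y = row x -> col y < col x -> smin (T y) = row y.
  move=> e l; apply: high0; apply/negP => hy.
  by have := minx y; rewrite /high1 hy e ex eqxx leqNgt l => /(_ isT).
have sT1 := raise_svrt sT hx below left.
apply: (@connect_trans _ _ (Theta (exist _ (raise hx) sT1))).
  by apply: IH; have := raise_measure hx; lia.
apply: connect1.
by rewrite (bool_irrelevance sT1 (raise_svrt sT hx below left)) raise_move.
Qed.

(** Here 1432-avoidance enters, through [lower_svrt]: it keeps the image of [Theta] stable under
    moves. *)
Lemma Theta_move (hw : avoids1432 w) (T : SVRT w) E :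
  moves (Theta T) E -> exists T' : SVRT w, Theta T' = E.
Proof.
case: T => T sT.
case/orP=> /existsP[i /existsP[j /existsP[i' /and3P[al /eqP eB /eqP eG]]]].
- exists (exist (@is_svrt n w) _ (lower_svrt false al hw)); apply: grave_ext.
  + by rewrite eB; exact: boxes_lower al.
  + by rewrite eG; apply: etrans (ghosts_lower _ al) _; rewrite setU0.
- exists (exist (@is_svrt n w) _ (lower_svrt true al hw)); apply: grave_ext.
  + by rewrite eB; exact: boxes_lower al.
  + by rewrite eG; exact: ghosts_lower al.
Qed.

Lemma row_filling_neq0 (x : rcell w) : [set row x] != set0.
Proof. by apply/set0Pn; exists (row x); rewrite set11. Qed.

(** The tableau of the starting diagram, from which paths of moves are followed. *)
Definition row_filling : filling w :=
  [ffun x => (Sub [set row x] (row_filling_neq0 x) : nset n)].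

Lemma mem_row_filling x a : (a \in val (row_filling x)) = (a == row x).
Proof. by rewrite ffunE SubK in_set1. Qed.

Lemma row_filling_svrt : is_svrt row_filling.
Proof.
apply/svrtP; split=> [x y a b|x y a b|x a]; rewrite !mem_row_filling.
- by move=> -> _ /eqP-> /eqP->.
- by move=> _ l /eqP-> /eqP->.
- by move/eqP->.
Qed.

Lemma KKoh_Theta (hw : avoids1432 w) E :
  E \in KKoh w -> exists T : SVRT w, Theta T = E.
Proof.
rewrite inE => /connectP[p].
pose T0 : SVRT w := exist _ row_filling row_filling_svrt.
have <- : Theta T0 = rothe_grave w.
  apply: fixed_Theta => x; apply/eqP.
  by rewrite -mem_row_filling smin_in.
elim: p T0 => [|E1 p IH] T /=; first by move=> _ ->; exists T.
by case/andP=> /(Theta_move hw)[T1 <-]; exact: IH.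
Qed.

End Closure.

Theorem theorem4p26 (n : nat) (w : 'S_n) (hw : avoids1432 w) :
  exists (Th : SVRT w -> {E : grave n | E \in KKoh w})
         (X : {E : grave n | E \in KKoh w} -> SVRT w),
    [/\ (forall T : SVRT w, val (Th T) = Theta T),
        (forall E : {E : grave n | E \in KKoh w},
           exists hE : thread_compatible w (val E), val (X E) = Xi hE),
        cancel Th X,
        cancel X Th
      & (forall (T : SVRT w) (i : 'I_n),
           grave_wt (Theta T) i = svrt_wt T i)].
Proof.
have exT (E : {E : grave n | E \in KKoh w}) :
    exists T : SVRT w, Theta T == val E.
  by have [T <-] := KKoh_Theta hw (valP E); exists T.
pose X E := xchoose (exT E).
have XP E : Theta (X E) = val E by apply/eqP; exact: (xchooseP (exT E)).
exists (fun T => exist _ (Theta T) (Theta_in_KKoh T)), X; split=> //.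
- move=> E; have := Theta_thread_compatible (X E) => hX.
  have hE : thread_compatible w (val E) by rewrite -XP.
  (* [Xi] depends on the compatibility proof, so [X E] is generalized before [val E] is replaced by
     its [Theta] image; both sides then reduce by [Xi_Theta]. *)
  exists hE; rewrite -(Xi_Theta hX).
  by move: (X E) (XP E) hX => T eT; move: hE; rewrite -eT => h h';
     rewrite !Xi_Theta.
- by move=> T; apply: Theta_inj; rewrite XP.
- by move=> E; apply: val_inj; rewrite /= XP.
- by move=> T i; exact: grave_wt_Theta.
Qed.
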